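(* Let $L$ be a non-Lie complex filiform Leibniz algebra in $FLeib_5$. Then $L$ is isomorphic to one of the following pairwise non-isomorphic Leibniz algebras (basis $e_0,e_1,e_2,e_3,e_4$; products of basis vectors not listed are zero; in all cases $e_0e_0=e_2$ and $e_ie_0=e_{i+1}$ for $1\le i\le 3$): 1) $L(1,0,\lambda)$, $\lambda\in\mathbb{C}$: $e_0e_1=e_3+\lambda e_4$, $e_1e_1=e_3$, $e_2e_1=e_4$ (different values of $\lambda$ giving non-isomorphic algebras); 2) $L(1,-2,0)$: $e_0e_1=e_3$, $e_1e_1=e_3-2e_4$, $e_2e_1=e_4$; 3) $L(1,-2,-2)$: $e_0e_1=e_3-2e_4$, $e_1e_1=e_3-2e_4$, $e_2e_1=e_4$; 4) $L(0,1,0)$: $e_1e_1=e_4$; 5) $L(0,1,1)$: $e_0e_1=e_4$, $e_1e_1=e_4$; 6) $L(0,0,1)$: $e_0e_1=e_4$; 7) $L(0,0,0)$: no further nonzero products.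
   Context: All algebras are over $\mathbb{C}$. A Leibniz algebra is an algebra (with bilinear product) satisfying $x(yz)=(xy)z-(xz)y$. With $L^1=L$ and $L^{k+1}=L^kL$, an $m$-dimensional Leibniz algebra is filiform if $\dim L^i=m-i$ for $2\le i\le m$. For $(\alpha_3,\alpha_4,\theta)\in\mathbb{C}^3$, $L(\alpha_3,\alpha_4,\theta)$ denotes the $5$-dimensional (filiform, non-Lie) Leibniz algebra with basis $e_0,\dots,e_4$ and nonzero products $e_0e_0=e_2$, $e_ie_0=e_{i+1}$ ($1\le i\le 3$), $e_0e_1=\alpha_3e_3+\theta e_4$, $e_1e_1=\alpha_3e_3+\alpha_4e_4$, $e_2e_1=\alpha_3e_4$. $FLeib_5$ is the class of all algebras $L(\alpha_3,\alpha_4,\theta)$. *)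

(* Defs.v *)
(* MathComp world, with the complex numbers R[i] over an abstract realType R. *)
From HB Require Import structures.
From mathcomp Require Import all_boot all_order all_algebra.
From mathcomp Require Export complex.
From mathcomp Require Export reals.

Set Implicit Arguments.
Unset Strict Implicit.
Unset Printing Implicit Defensive.

Import GRing.Theory.
Local Open Scope ring_scope.

(* Neither associativity nor a unit is assumed, so falgType does not apply. *)
Record algebra (K : fieldType) := Algebra {
  carrier :> vectType K;
  amul : {bilinear carrier -> carrier -> carrier}
}.

Section Algebras.
Variable K : fieldType.
Implicit Types L M : algebra K.

Definition leibniz L : Prop := forall x y z : L,
  amul L x (amul L y z) = amul L (amul L x y) z - amul L (amul L x z) y.

Definition lie L : Prop :=
  (forall x : L, amul L x x = 0) /\
  (forall x y z : L, amul L x (amul L y z) + amul L y (amul L z x)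
                     + amul L z (amul L x y) = 0).

Definition amulv L (U V : {vspace L}) : {vspace L} :=
  <<[seq amul L u v | u <- vbasis U, v <- vbasis V]>>%VS.

Lemma amulvP L (U V W : {vspace L}) :
  reflect (forall u v, u \in U -> v \in V -> amul L u v \in W)
          (amulv U V <= W)%VS.
Proof.
apply: (iffP idP) => [sUVW u v Uu Vv | sUVW].
  apply: (subvP sUVW).
  rewrite (coord_vbasis Uu) (coord_vbasis Vv) linear_sumlz rpred_sum // => i _.
  rewrite linear_sumr rpred_sum // => j _.
  rewrite linearZl_LR linearZr_LR !rpredZ // memv_span //.
  by apply: allpairs_f; apply: mem_nth; rewrite size_tuple.
apply/span_subvP => _ /allpairsP[[u v] /= [Uu Vv ->]].
by apply: sUVW; apply: vbasis_mem.
Qed.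

(* The descending central series: lcs L k is L^k for k >= 1, with L^1 = L and
   L^(k+1) = L^k L (the value at k = 0 is junk). *)
Definition lcs L (k : nat) : {vspace L} :=
  iter k.-1 (fun U => amulv U fullv) fullv.

Definition filiform L : Prop :=
  let m := (\dim (@fullv K L))%N in
  forall i : nat, (2 <= i <= m)%N -> (\dim (lcs L i) = m - i)%N.

Definition isomorphic L M : Prop :=
  exists2 f : {linear L -> M}, bijective f &
    forall x y : L, f (amul L x y) = amul M (f x) (f y).

End Algebras.

Section StructureConstants.
Variables (K : fieldType) (n : nat) (t : 'I_n -> 'I_n -> 'rV[K]_n).

Definition table_mul (x y : 'rV[K]_n) : 'rV[K]_n :=
  \sum_i \sum_j (x 0 i * y 0 j) *: t i j.

Lemma table_mul_is_bilinear : bilinear_for *:%R *:%R table_mul.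
Proof.
split=> [y | x] a u v /=.
  rewrite /table_mul scaler_sumr -big_split; apply: eq_bigr => i _ /=.
  rewrite scaler_sumr -big_split; apply: eq_bigr => j _ /=.
  by rewrite !mxE mulrDl scalerDl scalerA mulrA.
rewrite /table_mul scaler_sumr -big_split; apply: eq_bigr => i _ /=.
rewrite scaler_sumr -big_split; apply: eq_bigr => j _ /=.
by rewrite !mxE mulrDr scalerDl scalerA mulrCA.
Qed.

HB.instance Definition _ :=
  bilinear_isBilinear.Build K 'rV[K]_n 'rV[K]_n 'rV[K]_n *:%R *:%R
    table_mul table_mul_is_bilinear.

Definition table_algebra : algebra K := @Algebra K 'rV[K]_n table_mul.

Lemma table_algebraE i j :
  amul table_algebra (delta_mx 0 i) (delta_mx 0 j) = t i j.
Proof.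
rewrite /= /table_mul (bigD1 i) //= (bigD1 j) //= !mxE !eqxx mulr1 scale1r.
rewrite !big1 ?addr0 // => k nk; last first.
  by rewrite !mxE (negPf nk) andbF mulr0 scale0r.
by rewrite big1 // => l _; rewrite !mxE (negPf nk) andbF mul0r scale0r.
Qed.

End StructureConstants.

Section FLeib5.
Variable K : fieldType.

(* e_k = delta_mx 0 k; inord is only meaningful here for k <= 4. *)
Definition bas5 (k : nat) : 'rV[K]_5 := delta_mx 0 (inord k).

Definition fleib5_table (a3 a4 theta : K) (i j : 'I_5) : 'rV[K]_5 :=
  match nat_of_ord i, nat_of_ord j with
  | 0%N, 0%N => bas5 2
  | 1%N, 0%N => bas5 2
  | 2%N, 0%N => bas5 3
  | 3%N, 0%N => bas5 4
  | 0%N, 1%N => a3 *: bas5 3 + theta *: bas5 4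
  | 1%N, 1%N => a3 *: bas5 3 + a4 *: bas5 4
  | 2%N, 1%N => a3 *: bas5 4
  | _, _ => 0
  end.

(* L(alpha_3, alpha_4, theta) *)
Definition fleib5 (a3 a4 theta : K) : algebra K :=
  table_algebra (fleib5_table a3 a4 theta).

(* An algebra belongs to the class iff some basis of it has the above
   multiplication table, so the class is closed under isomorphism. *)
Definition in_FLeib5 (L : algebra K) : Prop :=
  exists a3 a4 theta : K, isomorphic L (fleib5 a3 a4 theta).

Inductive fleib5_class :=
  | Class1 of K | Class2 | Class3 | Class4 | Class5 | Class6 | Class7.

Definition fleib5_rep (c : fleib5_class) : algebra K :=
  match c with
  | Class1 lambda => fleib5 1 0 lambda
  | Class2 => fleib5 1 (- 2%:R) 0
  | Class3 => fleib5 1 (- 2%:R) (- 2%:R)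
  | Class4 => fleib5 0 1 0
  | Class5 => fleib5 0 1 1
  | Class6 => fleib5 0 0 1
  | Class7 => fleib5 0 0 0
  end.

End FLeib5.

(* Main.v *)
(* An isomorphism of L(a3, a4, th) onto L(a3', a4', th') sends e_0 to
   A e_0 + (D - A) e_1 and e_1 to D e_1 modulo the square of the algebra, with
   A, D nonzero.  In the coordinates a3, s = a4 + 2 a3^2 and t = th - a4, the
   condition on the parameters becomes diagonal:
     a3 A^2 = D a3',  s A^3 = D s',  t A^2 = t'.
   So the pattern of zeros of (a3, s, t) is an invariant, and over a field with
   square roots it is complete, except when a3 and s are both nonzero: there
   the normalization a3' = 1, s' = 2 forces A and D and leaves t as modulus. *)
Require Import Defs.
From mathcomp Require Import all_boot all_order all_algebra.
From mathcomp Require Import ring.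
From HB Require Import structures.

Set Implicit Arguments.
Unset Strict Implicit.
Unset Printing Implicit Defensive.

Import GRing.Theory Num.Theory.
Local Open Scope ring_scope.

Lemma isomorphic_trans (K : fieldType) (L M N : algebra K) :
  isomorphic L M -> isomorphic M N -> isomorphic L N.
Proof.
case=> f bij_f fM [g bij_g gM].
exists (g \o f : {linear L -> N}); first exact: bij_comp.
by move=> x y /=; rewrite fM gM.
Qed.

(** * Coordinates in dimension five *)

Section Row5.
Variable K : fieldType.
Implicit Types x y : 'rV[K]_5.

(** Vectors as literal quintuples turn an identity between products into five scalar identities
    within reach of [ring] or [field]. *)
Definition row5 (a b c d e : K) : 'rV[K]_5 :=
  \row_(i < 5) [:: a; b; c; d; e]`_i.

Definition coor5 x (k : nat) : K := x 0 (inord k).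

Lemma row5_coor x :
  x = row5 (coor5 x 0) (coor5 x 1) (coor5 x 2) (coor5 x 3) (coor5 x 4).
Proof.
apply/rowP => -[[|[|[|[|[|//]]]]] lti]; rewrite mxE /coor5 /=;
  by congr (x _ _); apply: val_inj; rewrite /= inordK.
Qed.

Lemma coor5_row5 a b c d e k : (k < 5)%N ->
  coor5 (row5 a b c d e) k = [:: a; b; c; d; e]`_k.
Proof. by move=> ltk; rewrite /coor5 mxE inordK. Qed.

Lemma row5_inj a b c d e a' b' c' d' e' :
  row5 a b c d e = row5 a' b' c' d' e' ->
  [/\ a = a', b = b', c = c', d = d' & e = e'].
Proof.
move=> /(congr1 coor5) eq_c.
by split; [have := congr1 (@^~ 0%N) eq_c | have := congr1 (@^~ 1%N) eq_c
  | have := congr1 (@^~ 2%N) eq_c | have := congr1 (@^~ 3%N) eq_c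
  | have := congr1 (@^~ 4%N) eq_c]; rewrite /= !coor5_row5.
Qed.

Lemma row5D a b c d e a' b' c' d' e' :
  row5 a b c d e + row5 a' b' c' d' e'
  = row5 (a + a') (b + b') (c + c') (d + d') (e + e').
Proof. by apply/rowP => -[[|[|[|[|[|//]]]]] lti]; rewrite !mxE. Qed.

Lemma row5N a b c d e :
  - row5 a b c d e = row5 (- a) (- b) (- c) (- d) (- e).
Proof. by apply/rowP => -[[|[|[|[|[|//]]]]] lti]; rewrite !mxE. Qed.

Lemma row5Z u a b c d e :
  u *: row5 a b c d e = row5 (u * a) (u * b) (u * c) (u * d) (u * e).
Proof. by apply/rowP => -[[|[|[|[|[|//]]]]] lti]; rewrite !mxE. Qed.

Lemma row5_0 : 0 = row5 0 0 0 0 0.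
Proof. by apply/rowP => -[[|[|[|[|[|//]]]]] lti]; rewrite !mxE. Qed.

Lemma bas5E k : (k < 5)%N ->
  bas5 K k = row5 (k == 0)%:R (k == 1)%:R (k == 2)%:R (k == 3)%:R (k == 4)%:R.
Proof.
by case: k => [|[|[|[|[|//]]]]] _; apply/rowP => -[[|[|[|[|[|//]]]]] lti];
  rewrite !mxE -!val_eqE /= inordK.
Qed.

End Row5.

(** * Products in coordinates and the isomorphism criterion *)

Section Classification.
Variable K : fieldType.

(** Serves for certificates: after [subr0_eq], the zero on the right is rewritten as a combination
    of known equations, and [ring] compares the two sides. *)
Lemma linear_comb_eq0 (c c' l r l' r' : K) :
  l = r -> l' = r' -> c * (l - r) + c' * (l' - r') = 0.
Proof. by move=> -> ->; rewrite !subrr !mulr0 addr0. Qed.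

Lemma fleib5_mul (a3 a4 th x0 x1 x2 x3 x4 y0 y1 y2 y3 y4 : K) :
  amul (fleib5 a3 a4 th) (row5 x0 x1 x2 x3 x4) (row5 y0 y1 y2 y3 y4)
  = row5 0 0 ((x0 + x1) * y0) (x2 * y0 + a3 * (x0 + x1) * y1)
         (x3 * y0 + (th * x0 + a4 * x1 + a3 * x2) * y1).
Proof.
rewrite /= /table_mul !big_ord_recl !big_ord0 /fleib5_table /= /bump /=.
rewrite !bas5E //= !(row5_0, row5Z, row5D) !mxE /=.
by congr row5; ring.
Qed.

Lemma leibniz_fleib5 (a3 a4 th : K) : leibniz (fleib5 a3 a4 th).
Proof.
move=> x y z; rewrite (row5_coor x) (row5_coor y) (row5_coor z).
by rewrite !(fleib5_mul, row5N, row5D); congr row5; ring.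
Qed.

Lemma fleib5_isoP (a3 a4 th a3' a4' th' : K) :
  isomorphic (fleib5 a3 a4 th) (fleib5 a3' a4' th') <->
  exists A D : K, [/\ A != 0, D != 0, a3 * A ^+ 2 = D * a3',
    (a4 + 2%:R * a3 ^+ 2) * A ^+ 3 = D * (a4' + 2%:R * a3' ^+ 2)
    & (th - a4) * A ^+ 2 = th' - a4'].
Proof.
split.
  case=> f /bij_inj inj_f fM.
  pose p k := f (bas5 K k).
  have pM i j z : amul (fleib5 a3 a4 th) (bas5 K i) (bas5 K j) = z ->
    amul (fleib5 a3' a4' th') (p i) (p j) = f z by move=> <-; rewrite fM.
  have pX i : (0 < i < 4)%N ->
      amul (fleib5 a3' a4' th') (p i) (p 0) = p i.+1.
    case: i => [|[|[|[|//]]]] // _; apply: pM; rewrite !bas5E // fleib5_mul;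
      by congr row5 => /=; ring.
  have p10 := pX 1 isT.
  have p20 := pX 2 isT.
  have p30 := pX 3 isT.
  have p00 : amul (fleib5 a3' a4' th') (p 0) (p 0) = p 2.
    by apply: pM; rewrite !bas5E // fleib5_mul; congr row5 => /=; ring.
  have p01 : amul (fleib5 a3' a4' th') (p 0) (p 1) = a3 *: p 3 + th *: p 4.
    rewrite -!linearZ -linearD; apply: pM.
    by rewrite !bas5E // !(fleib5_mul, row5Z, row5D); congr row5 => /=; ring.
  have p11 : amul (fleib5 a3' a4' th') (p 1) (p 1) = a3 *: p 3 + a4 *: p 4.
    rewrite -!linearZ -linearD; apply: pM.
    by rewrite !bas5E // !(fleib5_mul, row5Z, row5D); congr row5 => /=; ring.
  have p4N0 : p 4 <> 0.
    rewrite /p -(linear0 f) => /inj_f; rewrite bas5E // row5_0.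
    by case/row5_inj => _ _ _ _ /eqP; rewrite oner_eq0.
  move: p00 p10 p20 p30 p01 p11 p4N0.
  rewrite (row5_coor (p 0)) (row5_coor (p 1)).
  move: (coor5 (p 0)) (coor5 (p 1)) => u v.
  set A := u 0; set B := u 1.
  move=> p00; rewrite -p00 !fleib5_mul => /row5_inj[_ _ e12 e13 _] p20.
  rewrite -p20 fleib5_mul => p30; rewrite -p30.
  rewrite !(fleib5_mul, row5_0, row5Z, row5D).
  move=> /row5_inj[_ _ e22 e23 e24] /row5_inj[_ _ _ _ e34] p4N0.
  (* At this point [p 4] has become A^3 (A + B) e_4, so its nonvanishing gives that of both
     factors. *)
  have AN0 : A != 0.
    by apply: contra_notN p4N0 => /eqP ->; congr row5; ring.
  have DN0 : A + B != 0.
    by apply: contra_notN p4N0 => /eqP ->; congr row5; ring.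
  exists A, (A + B).
  have v0 : v 0 = 0.
    by apply: (mulfI DN0); rewrite -[LHS]/((u 0 + u 1) * v 0) e22; ring.
  have v1 : v 1 = A + B.
    by apply: (mulIf AN0); rewrite -e12 v0 add0r.
  have v2 : v 2 = u 2.
    apply: (mulIf AN0); apply: (addIr (a3' * (A + B) * B)).
    by rewrite -e13 v0 v1; ring.
  rewrite v1 v0 v2 in e23 e24 e34.
  have a3E : a3 * A ^+ 2 = (A + B) * a3'.
    apply: (mulfI DN0); apply: subr0_eq.
    by rewrite -[RHS](linear_comb_eq0 (-1) 0 e23 e23); ring.
  split=> //.
  - apply: (mulfI DN0); apply: subr0_eq.
    (* The multiple [- u 2] of [a3E] cancels the e_2-coordinate of [p 0]; the other one turns the
       cross term 2 a3 a3' A B into squares, whence the shift by 2 a3^2 in s. *)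
    rewrite -[RHS](linear_comb_eq0 (-1)
      (2%:R * (A + B) * (a3 * A + a3') - u 2) e34 a3E).
    ring.
  (* Subtracting the e_4-components of [p11] and [p01] eliminates a3, a3' and [u 2]; only t and t'
     survive. *)
  - apply: (mulfI (mulf_neq0 AN0 DN0)); apply: subr0_eq.
    by rewrite -[RHS](linear_comb_eq0 (-1) 1 e24 e34); ring.
case=> A [D [AN0 DN0 a3E sE tE]].
(* Once the source parameters are solved for, multiplicativity of the map below is an identity of
   rational functions in A, D and the target parameters. *)
have eq_a3 : a3 = D * a3' / A ^+ 2 by rewrite -a3E mulfK ?expf_neq0.
have eq_a4 : a4 = D * (a4' + 2%:R * a3' ^+ 2) / A ^+ 3 - 2%:R * a3 ^+ 2.
  by rewrite -sE mulfK ?expf_neq0 // addrK.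
have eq_th : th = (th' - a4') / A ^+ 2 + a4.
  by rewrite -tE mulfK ?expf_neq0 // subrK.
pose B := D - A.
(* The e_3-component (D - A) (th' - a4') of the image of e_1 makes the images of
   e_0 e_0 and e_1 e_0 agree; those of e_2, e_3, e_4 are then forced. *)
pose f (x : 'rV[K]_5) := row5 (A * coor5 x 0) (B * coor5 x 0 + D * coor5 x 1)
  (A * D * coor5 x 2)
  (B * (th' - a4') * coor5 x 1 + B * D * a3' * coor5 x 2
   + A ^+ 2 * D * coor5 x 3)
  (B * (A * th' + B * a4') * coor5 x 2 + 2%:R * A * B * D * a3' * coor5 x 3
   + A ^+ 3 * D * coor5 x 4).
have f_lin : linear f.
  move=> k x y; rewrite /f row5Z row5D /coor5 !mxE.
  by congr row5; ring.
pose fL : {linear fleib5 a3 a4 th -> fleib5 a3' a4' th'} :=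
  HB.pack f (GRing.isLinear.Build _ _ _ _ f f_lin).
have fLE z : fL z = f z by [].
exists fL.
  (* The map is triangular with diagonal A, D, A D, A^2 D, A^3 D, so forward substitution inverts
     it. *)
  pose g (y : 'rV[K]_5) :=
    let x0 := coor5 y 0 / A in
    let x1 := (coor5 y 1 - B * x0) / D in
    let x2 := coor5 y 2 / (A * D) in
    let x3 := (coor5 y 3 - B * (th' - a4') * x1 - B * D * a3' * x2)
                / (A ^+ 2 * D) in
    let x4 := (coor5 y 4 - B * (A * th' + B * a4') * x2
                - 2%:R * A * B * D * a3' * x3) / (A ^+ 3 * D) in
    row5 x0 x1 x2 x3 x4.
  exists g => x; rewrite [RHS]row5_coor /fL /= /f /g !coor5_row5 //=;
    by congr row5; field; rewrite ?AN0 ?DN0.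
move=> x y; rewrite (row5_coor x) (row5_coor y) !fLE.
rewrite fleib5_mul /f fleib5_mul !coor5_row5 //=.
rewrite eq_th eq_a4 eq_a3 /B.
by congr row5; field; rewrite ?AN0 ?DN0.
Qed.

Lemma fleib5_iso_eq0 (a3 a4 th a3' a4' th' : K) :
  isomorphic (fleib5 a3 a4 th) (fleib5 a3' a4' th') ->
  [/\ (a3 == 0) = (a3' == 0),
      (a4 + 2%:R * a3 ^+ 2 == 0) = (a4' + 2%:R * a3' ^+ 2 == 0)
    & (th - a4 == 0) = (th' - a4' == 0)].
Proof.
case/fleib5_isoP=> A [D [/negPf A0 /negPf D0 a3E sE tE]]; split.
- by have /(congr1 (eq_op^~ 0)) := a3E; rewrite /= mulf_eq0 expf_eq0 /= A0 orbF
    mulf_eq0 D0.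
- by have /(congr1 (eq_op^~ 0)) := sE; rewrite /= mulf_eq0 expf_eq0 /= A0 orbF
    mulf_eq0 D0.
- by rewrite -tE mulf_eq0 expf_eq0 /= A0 orbF.
Qed.

End Classification.

(** * Reduction to the representatives, and their distinctness *)

Lemma fleib5_class_iso (K : numClosedFieldType) (a3 a4 th : K) :
  exists c : fleib5_class K, isomorphic (fleib5 a3 a4 th) (fleib5_rep c).
Proof.
(* In order, the seven classes have (a3, s, t) = (1, 2, lambda), (1, 0, 2), (1, 0, 0), (0, 1, -1),
   (0, 1, 0), (0, 0, 1), (0, 0, 0); the witnesses A, D below scale the given triple to one of
   these. *)
set s := a4 + 2%:R * a3 ^+ 2; set t := th - a4.
have two0 : 2%:R != 0 :> K by rewrite pnatr_eq0.
have [a30|a3N0] := eqVneq a3 0.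
  have sE : s = a4 by rewrite /s a30; ring.
  have [a40|a4N0] := eqVneq a4 0.
    have [t0|tN0] := eqVneq t 0.
      exists (Class7 K); apply/fleib5_isoP; exists 1, 1.
      by rewrite oner_neq0 -/s -/t sE t0 a30 a40; split=> //; ring.
    exists (Class6 K); apply/fleib5_isoP; exists (sqrtC t^-1), 1.
    rewrite sqrtC_eq0 invr_eq0 oner_neq0 -/s -/t sE a30 a40 sqrtCK divff //.
    by split=> //; ring.
  have [t0|tN0] := eqVneq t 0.
    exists (Class5 K); apply/fleib5_isoP; exists 1, a4.
    by rewrite oner_neq0 -/s -/t sE t0 a30; split=> //; ring.
  (* The target has t' = -1, whence the sign under the root; s' = 1 then fixes D. *)
  exists (Class4 K); apply/fleib5_isoP; set A := sqrtC (- t^-1).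
  have A2 : A ^+ 2 = - t^-1 by rewrite sqrtCK.
  have AN0 : A != 0 by rewrite sqrtC_eq0 oppr_eq0 invr_eq0.
  exists A, (a4 * A ^+ 3).
  rewrite mulf_neq0 ?expf_neq0 // -/s -/t sE a30 A2.
  by split=> //; field.
have [s0|sN0] := eqVneq s 0.
  have [t0|tN0] := eqVneq t 0.
    exists (Class3 K); apply/fleib5_isoP; exists 1, a3.
    by rewrite oner_neq0 -/s -/t s0 t0; split=> //; ring.
  exists (Class2 K); apply/fleib5_isoP; set A := sqrtC (2%:R / t).
  have A2 : A ^+ 2 = 2%:R / t by rewrite sqrtCK.
  have AN0 : A != 0 by rewrite sqrtC_eq0 mulf_neq0 ?invr_eq0.
  exists A, (a3 * A ^+ 2).
  rewrite AN0 mulf_neq0 ?expf_neq0 // -/s -/t s0.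
  by split=> //; rewrite ?A2; field.
(* The targets a3' = 1 and s' = 2 require D = a3 A^2 and s A^3 = 2 D, hence this A, without any
   root; lambda is the resulting t A^2. *)
set A := 2%:R * a3 / s.
have AN0 : A != 0 by rewrite !mulf_neq0 ?invr_eq0.
exists (Class1 (t * A ^+ 2)); apply/fleib5_isoP; exists A, (a3 * A ^+ 2).
rewrite AN0 mulf_neq0 ?expf_neq0 // -/s -/t.
by split=> //; rewrite ?mulr1 ?subr0 // /A; field.
Qed.

Lemma fleib5_rep_inj (K : numFieldType) (c d : fleib5_class K) :
  isomorphic (fleib5_rep c) (fleib5_rep d) -> c = d.
Proof.
have two0 : (2%:R == 0 :> K) = false by rewrite pnatr_eq0.
(* Distinct constructors differ in the zero pattern of (a3, s, t), so only two members of the first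
   family remain to be compared. *)
case: c d => [l||||||] [m||||||] //=; try by case/fleib5_iso_eq0;
  rewrite ?(expr2, mulr0, mulr1, addr0, add0r, subr0, sub0r, subrr, addNr,
    opprK, oppr_eq0, oner_eq0, eqxx, two0).
case/fleib5_isoP=> A [D [AN0 DN0]].
rewrite expr1n !mulr1 !add0r !subr0 mul1r => <- eqA <-; congr Class1.
(* With D = A^2 substituted, the relation for s = s' = 2 reads 2 A^3 = 2 A^2. *)
have A1 : A = 1.
  apply: (mulfI (expf_neq0 2 AN0)); apply: (mulfI (negbT two0)).
  by rewrite mulr1 -exprSr eqA mulrC.
by rewrite A1 expr1n mulr1.
Qed.

Theorem theorem2p1p3 (R : realType) :
  (forall L : algebra R[i],
     leibniz L -> filiform L -> ~ lie L -> in_FLeib5 L ->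
     exists c : fleib5_class R[i], isomorphic L (fleib5_rep c)) /\
  (forall c : fleib5_class R[i], leibniz (fleib5_rep c)) /\
  (forall c d : fleib5_class R[i],
     c <> d -> ~ isomorphic (fleib5_rep c) (fleib5_rep d)).
Proof.
split=> [L _ _ _ [a3 [a4 [th isoL]]] |].
  have [c iso_c] := fleib5_class_iso a3 a4 th.
  by exists c; apply: isomorphic_trans isoL iso_c.
split=> [c | c d neq_cd /fleib5_rep_inj //].
by case: c => * /=; apply: leibniz_fleib5.
Qed.
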